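(* Let $R$ be a ring which is $\Sigma$-semi-compact as a left $R$-module. Then each $(\aleph_0,1)$-flat left $R$-module is singly projective.
   Context: Rings are associative with identity and modules are unitary. For a left $R$-module $M$ and a left ideal $I$ of $R$, $M[I]=\{m\in M\mid Im=0\}$. $M$ is semi-compact if every set of congruences $x\equiv x_\alpha\pmod{M[I_\alpha]}$ ($\alpha\in\Lambda$, $x_\alpha\in M$, $I_\alpha$ a left ideal of $R$), each finite subset of which has a common solution in $M$, has a simultaneous solution in $M$. $M$ is $\Sigma$-semi-compact if all direct sums of copies of $M$ are semi-compact. A left $R$-module $M$ is $(m,n)$-flat ($m,n$ positive integers) if for each $n$-generated right submodule $K$ of $R^m$ the homomorphism $K\otimes_R M\to R^m\otimes_R M$ induced by the inclusion is injective; $M$ is $(\aleph_0,1)$-flat if it is $(m,1)$-flat for each integer $m>0$. A left $R$-module $M$ is singly projective if every homomorphism from a cyclic left $R$-module into $M$ factors through a free left $R$-module. *)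

(* Defs.v *)
From HB Require Import structures.
From mathcomp Require Import all_boot all_algebra.
From mathcomp Require Import generic_quotient ring_quotient.
From mathcomp Require Import boolp classical_sets functions cardinality.
From mathcomp.multinomials Require Import freeg.

Set Implicit Arguments.
Unset Strict Implicit.
Unset Printing Implicit Defensive.

Import GRing.Theory.
Local Open Scope ring_scope.
Local Open Scope classical_set_scope.

(* Rings are of type pzRingType: associative, unital, possibly noncommutative
   and possibly zero.  Left R-modules are of type lmodType R.  Right R-modules
   are of type lmodType R^c: there, with a in R, a *: k is the element k a. *)

Section DirectSum.
Variables (R : pzRingType) (I : Type) (M : lmodType R).

Definition finsupp_pred : {pred I -> M} :=
  fun f => `[< finite_set [set i | f i <> 0] >].

(* The direct sum of copies of M indexed by I. *)
Record dsum := DSum { dsum_fun :> I -> M; _ : dsum_fun \in finsupp_pred }.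

HB.instance Definition _ := [isSub for dsum_fun].
HB.instance Definition _ := [Choice of dsum by <:].

Fact finsupp_submod_closed : submod_closed finsupp_pred.
Proof.
split=> [|a f g /asboolP ff /asboolP fg]; apply/asboolP.
  by rewrite (_ : [set i | _] = set0) // -subset0 => i /=; apply.
apply: (@sub_finite_set _ _ ([set i | f i <> 0] `|` [set i | g i <> 0])).
  move=> i /= h; have [f0|nf0] := pselect (f i = 0); last by left.
  right=> g0; apply: h; change (a *: f i + g i = 0).
  by rewrite f0 g0 scaler0 addr0.
by rewrite finite_setU.
Qed.

HB.instance Definition _ :=
  GRing.isSubmodClosed.Build R (I -> M) finsupp_pred finsupp_submod_closed.
HB.instance Definition _ := [SubChoice_isSubLmodule of dsum by <:].

End DirectSum.

Arguments dsum {R} I M.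

Section SemiCompact.
Variable R : pzRingType.

Definition left_ideal (J : set R) : Prop :=
  [/\ J 0, forall a b, J a -> J b -> J (a + b) & forall r a, J a -> J (r * a)].

(* M[J] *)
Definition annihilated (M : lmodType R) (J : set R) : set M :=
  [set m | forall a, J a -> a *: m = 0].

Arguments annihilated M J : clear implicits.

Definition semi_compact (M : lmodType R) : Prop :=
  forall (L : Type) (x : L -> M) (J : L -> set R),
    (forall l, left_ideal (J l)) ->
    (forall F : set L, finite_set F ->
       exists y : M, forall l, F l -> annihilated M (J l) (y - x l)) ->
    exists y : M, forall l, annihilated M (J l) (y - x l).

Definition sigma_semi_compact (M : lmodType R) : Prop :=
  forall I : Type, semi_compact (dsum I M).

End SemiCompact.

Section Tensor.
Variables (R : pzRingType) (K : lmodType R^c) (M : lmodType R).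

Local Notation pure k m := (<< ((k, m) : K * M) >> : {freeg (K * M)}).

(* The subgroup of the free abelian group on K x M generated by the
   bilinearity relations and by the balancing relations (k a, m) - (k, a m). *)
Inductive tensor_rel : {freeg (K * M)} -> Prop :=
| tensor_rel0 : tensor_rel 0
| tensor_relB u v : tensor_rel u -> tensor_rel v -> tensor_rel (u - v)
| tensor_relDl k1 k2 m :
    tensor_rel (pure (k1 + k2) m - pure k1 m - pure k2 m)
| tensor_relDr k m1 m2 :
    tensor_rel (pure k (m1 + m2) - pure k m1 - pure k m2)
| tensor_rel_bal (a : R) k m :
    tensor_rel (pure ((a : R^c) *: k) m - pure k (a *: m)).

Definition tensor_pred : {pred {freeg (K * M)}} := fun u => `[< tensor_rel u >].

Fact tensor_pred_closed : zmod_closed tensor_pred.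
Proof.
split=> [|u v /asboolP ru /asboolP rv]; apply/asboolP; first exact: tensor_rel0.
exact: tensor_relB.
Qed.

HB.instance Definition _ :=
  GRing.isZmodClosed.Build {freeg (K * M)} tensor_pred tensor_pred_closed.

Definition tensor : zmodType := {ideal_quot tensor_pred}.

Definition tensor_class (u : {freeg (K * M)}) : tensor :=
  \pi_({ideal_quot tensor_pred})%qT u.

Definition tpure (k : K) (m : M) : tensor := tensor_class (pure k m).

Fact tensor_class_is_zmod_morphism : zmod_morphism tensor_class.
Proof. by move=> u v; rewrite /tensor_class !piE. Qed.

HB.instance Definition _ := GRing.isZmodMorphism.Build {freeg (K * M)} tensor
  tensor_class tensor_class_is_zmod_morphism.

Lemma tensor_class_eq0 (u : {freeg (K * M)}) :
  tensor_class u = 0 <-> tensor_rel u.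
Proof.
rewrite -(raddf0 tensor_class); split=> [/eqP|h].
  by rewrite -Quotient.idealrBE subr0 => /asboolP.
by apply/eqP; rewrite -Quotient.idealrBE subr0; apply/asboolP.
Qed.

Lemma tpureDl k1 k2 m : tpure (k1 + k2) m = tpure k1 m + tpure k2 m.
Proof.
apply/eqP; rewrite -subr_eq0 opprD addrA -!raddfB.
by apply/eqP/tensor_class_eq0; exact: tensor_relDl.
Qed.

Lemma tpureDr k m1 m2 : tpure k (m1 + m2) = tpure k m1 + tpure k m2.
Proof.
apply/eqP; rewrite -subr_eq0 opprD addrA -!raddfB.
by apply/eqP/tensor_class_eq0; exact: tensor_relDr.
Qed.

Lemma tpure_bal (a : R) k m : tpure ((a : R^c) *: k) m = tpure k (a *: m).
Proof.
apply/eqP; rewrite -subr_eq0 -raddfB.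
by apply/eqP/tensor_class_eq0; exact: tensor_rel_bal.
Qed.

End Tensor.

Section TensorMap.
Variables (R : pzRingType) (K K' : lmodType R^c) (M : lmodType R).
Variable f : {linear K -> K'}.

Let lift (u : {freeg (K * M)}) : tensor K' M :=
  fglift (fun km => tpure (f km.1) km.2 : zmodule (tensor K' M)) u.

(* The map f (x) id_M: the additive extension of (k, m) |-> f k (x) m to the
   free abelian group, applied to a representative. *)
Definition tensor_map (t : tensor K M) : tensor K' M :=
  lift (repr (t : {ideal_quot @tensor_pred R K M})).

Let liftB u v : lift (u - v) = lift u - lift v.
Proof. exact: (@lift_is_additive _ _ (zmodule (tensor K' M))). Qed.

Let lift1 k m : lift << (k, m) >> = tpure (f k) m.
Proof. by rewrite /lift liftU scale1r. Qed.

Let lift_rel u : tensor_rel u -> lift u = 0.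
Proof.
elim=> {u} [|u v _ hu _ hv|k1 k2 m|k m1 m2|a k m].
- by have := liftB 0 0; rewrite !subrr.
- by rewrite liftB hu hv subr0.
- by rewrite !liftB !lift1 linearD tpureDl addrAC addrK subrr.
- by rewrite !liftB !lift1 tpureDr addrAC addrK subrr.
- by rewrite !liftB !lift1 linearZ tpure_bal subrr.
Qed.

Lemma tensor_map_class (u : {freeg (K * M)}) :
  tensor_map (tensor_class u) = lift u.
Proof.
apply/eqP; rewrite -subr_eq0 -liftB lift_rel //.
apply/asboolP; rewrite -[`[< _ >]]/(_ \in @tensor_pred R K M).
by rewrite Quotient.idealrBE reprK.
Qed.

Lemma tensor_map_pure k m : tensor_map (tpure k m) = tpure (f k) m.
Proof. by rewrite tensor_map_class lift1. Qed.

Fact tensor_map_is_zmod_morphism : zmod_morphism tensor_map.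
Proof.
move=> s t.
have repE (w : tensor K M) : w = tensor_class (repr (w : {ideal_quot _})).
  by rewrite /tensor_class reprK.
by rewrite (repE s) (repE t) -raddfB !tensor_map_class liftB.
Qed.

HB.instance Definition _ := GRing.isZmodMorphism.Build (tensor K M)
  (tensor K' M) tensor_map tensor_map_is_zmod_morphism.

End TensorMap.

Arguments tensor_map {R K K'} M f t.

Section GeneratedSubmodule.
Variables (R : pzRingType) (V : lmodType R) (n : nat) (g : 'I_n -> V).

Definition submod_gen_pred : {pred V} :=
  fun v => `[< exists c : 'I_n -> R, v = \sum_i c i *: g i >].

(* The submodule of V generated by g_0, ..., g_{n-1}. *)
Record submod_gen := SubmodGen {
  submod_gen_val :> V;
  _ : submod_gen_val \in submod_gen_pred
}.

HB.instance Definition _ := [isSub for submod_gen_val].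
HB.instance Definition _ := [Choice of submod_gen by <:].

Fact submod_gen_closed : submod_closed submod_gen_pred.
Proof.
split=> [|a u v /asboolP[c ->] /asboolP[d ->]]; apply/asboolP.
  by exists (fun=> 0); rewrite big1 // => i _; rewrite scale0r.
exists (fun i => a * c i + d i); rewrite scaler_sumr -big_split /=.
by apply: eq_bigr => i _; rewrite scalerDl scalerA.
Qed.

HB.instance Definition _ :=
  GRing.isSubmodClosed.Build R V submod_gen_pred submod_gen_closed.
HB.instance Definition _ := [SubChoice_isSubLmodule of submod_gen by <:].

Definition submod_gen_incl : {linear submod_gen -> V} := val.

End GeneratedSubmodule.

(* The right module R^m is 'rV[R^c]_m, and its n-generated submodules are the
   submod_gen g for g : 'I_n -> 'rV[R^c]_m. *)
Definition mn_flat (R : pzRingType) (m n : nat) (M : lmodType R) : Prop :=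
  forall g : 'I_n -> 'rV[R^c]_m,
    injective (tensor_map M (submod_gen_incl g)).

Definition aleph0_1_flat (R : pzRingType) (M : lmodType R) : Prop :=
  forall m : nat, (0 < m)%N -> mn_flat m 1 M.

Definition is_cyclic (R : pzRingType) (C : lmodType R) : Prop :=
  exists x : C, forall y : C, exists a : R, y = a *: x.

Definition is_free (R : pzRingType) (F : lmodType R) : Prop :=
  exists (B : Type) (e : {linear dsum B R^o -> F}), bijective e.

Definition singly_projective (R : pzRingType) (M : lmodType R) : Prop :=
  forall (C : lmodType R) (f : {linear C -> M}), is_cyclic C ->
    exists (F : lmodType R) (g : {linear C -> F}) (h : {linear F -> M}),
      is_free F /\ f =1 h \o g.

(* Main.v *)
Require Import Defs.
From mathcomp Require Import ssralg.
From HB Require Import structures.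
From mathcomp Require Import all_boot all_algebra.
From mathcomp Require Import boolp classical_sets cardinality.
From mathcomp.multinomials Require Import freeg.

Local Open Scope ring_scope.

Set Implicit Arguments.
Unset Strict Implicit.
Unset Printing Implicit Defensive.

Import GRing.Theory.
Local Open Scope classical_set_scope.

(** The statement reduces to two facts about annihilators.

    First, if all direct sums of copies of M are semi-compact, then for every
    subset A of R the subgroup M[A] = {m | A m = 0} is already M[A0] for a
    finite A0 contained in A ([sigma_semi_compact_finite_annihilator]).
    Otherwise there are a_0, a_1, ... in A and b_0, b_1, ... in M with
    a_i b_n = 0 for i < n and a_n b_n <> 0; in the direct sum of countably many
    copies of M, the truncations x_n = (b_0, ..., b_n, 0, 0, ...) give a finitely
    solvable set of congruences y = x_n modulo the annihilator of R a_n, and a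
    solution y would have no zero coordinate.

    Second, flatness with respect to the right submodule of R^p generated by
    k = (a_1, ..., a_p) is a relation criterion ([mn_flat1_relation]): if every
    a_i kills m, then k (x) m vanishes in R^p (x) M, hence in k R (x) M, and the
    latter is M modulo the subgroup of the finite sums of b_j m_j with k b_j = 0.

    Now let C = R x be cyclic, f : C -> M, and A the annihilator of x.  With
    A0 contained in A finite and having the same right annihilator as A, the
    criterion gives f x = b_1 m_1 + ... + b_q m_q with A0 b_j = 0, and so
    A b_j = 0.  Therefore x |-> (b_1, ..., b_q) is a well defined map C -> R^q,
    and f is its composite with the map R^q -> M sending the basis to the
    m_j. *)

(** * Finiteness of annihilators *)

Lemma finite_set_nat_ub (F : set nat) :
  finite_set F -> exists N, forall i, F i -> (i < N)%N.
Proof.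
move=> /finite_seqP[s ->]; exists (\max_(i <- s) i).+1 => i /= si.
by rewrite ltnS; apply: leq_bigmax_seq.
Qed.

Section Annihilators.
Variables (R : pzRingType) (M : lmodType R).

Definition annihilates (s : seq R) (m : M) : Prop :=
  forall a, a \in s -> a *: m = 0.

(** Diagonal sequences: b_n shows that the annihilator of a_0, ..., a_(n-1) is
    larger than that of [A], and a_n is an element of [A] that detects this. *)
Lemma annihilator_sequence (A : set R) :
  (forall s : seq R, (forall a, a \in s -> A a) ->
     exists a m, [/\ A a, annihilates s m & a *: m <> 0]) ->
  exists (a : nat -> R) (b : nat -> M),
    (forall i n, (i < n)%N -> a i *: b n = 0) /\
    (forall n, a n *: b n <> 0).
Proof.
move=> step.
have /choice[next nextP] (s : seq R) : exists p : R * M,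
    (forall a, a \in s -> A a) ->
    [/\ A p.1, annihilates s p.2 & p.1 *: p.2 <> 0].
  have [As|nAs] := pselect (forall a, a \in s -> A a); last by exists (0, 0).
  by have [a [m h]] := step s As; exists (a, m).
pose S n := iter n (fun s => (next s).1 :: s) [::].
have AS n a : a \in S n -> A a.
  elim: n a => [//|n IHn] a; rewrite /S iterS inE => /predU1P[->|].
    by case: (nextP _ IHn).
  exact: IHn.
have mem_S i n : (i < n)%N -> (next (S i)).1 \in S n.
  elim: n => // n IHn; rewrite ltnS leq_eqVlt /S iterS inE.
  by move=> /predU1P[->|/IHn h]; rewrite ?eqxx // [_ \in _]h orbT.
exists (fun n => (next (S n)).1), (fun n => (next (S n)).2); split.
  by move=> i n /mem_S h; case: (nextP _ (AS n)) => _ + _; apply.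
by move=> n; case: (nextP _ (AS n)).
Qed.

Lemma truncation_finsupp (b : nat -> M) (n : nat) :
  (fun k => if (k <= n)%N then b k else 0) \in @finsupp_pred R nat M.
Proof.
apply/asboolP; apply: (sub_finite_set _ (finite_II n.+1)) => k /=.
by rewrite ltnS; case: leqP.
Qed.

(** This is the descending chain condition on the subgroups M[A].  An infinite
    descent yields congruences that force the n-th coordinate of a solution to be
    b_n up to the annihilator of a_n, hence nonzero for every n: such a solution
    lies in the product of the copies of M but not in their sum. *)
Lemma sigma_semi_compact_finite_annihilator (A : set R) :
  sigma_semi_compact M ->
  exists2 s : seq R, (forall a, a \in s -> A a) &
    forall m : M, annihilates s m -> forall a, A a -> a *: m = 0.
Proof.
move=> compM; apply: contrapT => nofin.
have [s As|a [b [ab0 abn0]]] := @annihilator_sequence A _.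
  apply: contrapT => ns; apply: nofin; exists s => // m sm a Aa.
  by apply: contrapT => am; apply: ns; exists a, m.
pose x n : dsum nat M := DSum (truncation_finsupp b n).
have [||y yP] := compM nat nat x (fun n => [set c | exists r, c = r * a n]).
- move=> n; split=> [|_ _ [r ->] [t ->]|r _ [t ->]].
  + by exists 0; rewrite mul0r.
  + by exists (r + t); rewrite mulrDl.
  + by exists (r * t); rewrite mulrA.
(* A far enough truncation is a solution, as a_n kills the b_k with n < k. *)
- move=> F /finite_set_nat_ub[N FN]; exists (x N) => n /FN nN _ [r ->].
  apply/val_inj/funext => k.
  change ((r * a n) *: ((if (k <= N)%N then b k else 0) -
                        (if (k <= n)%N then b k else 0)) = 0).
  rewrite -scalerA; case: (leqP k n) => [kn|nk].
    by rewrite (leq_trans kn (ltnW nN)) subrr !scaler0.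
  by case: leqP => _; rewrite subr0 ?(ab0 _ _ nk) !scaler0.
have [N suppN] : exists N, forall i, val y i <> 0 -> (i < N)%N.
  by apply: finite_set_nat_ub; apply/asboolP; apply: (valP y).
have yN : val y N = 0 by apply: contrapT => /suppN; rewrite ltnn.
have aN_gen : exists r, a N = r * a N by exists 1; rewrite mul1r.
have /(congr1 (fun z : dsum nat M => val z N)) := yP N (a N) aN_gen.
change (a N *: (val y N - (if (N <= N)%N then b N else 0)) = 0 -> False).
by rewrite yN leqnn sub0r scalerN => /eqP; rewrite oppr_eq0 => /eqP; apply: abn0.
Qed.

End Annihilators.

(** * Flatness as a criterion on relations *)

(** Nonvanishing in a tensor product is detected by maps that are biadditive and
    balanced modulo a subgroup [T]. *)
Lemma tpure0_balanced_map (R : pzRingType) (K : lmodType R^c) (M : lmodType R)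
    (V : zmodType) (T : set V) (beta : K -> M -> V) :
  T 0 -> (forall u v, T u -> T v -> T (u - v)) ->
  (forall k1 k2 m, T (beta (k1 + k2) m - beta k1 m - beta k2 m)) ->
  (forall k m1 m2, T (beta k (m1 + m2) - beta k m1 - beta k m2)) ->
  (forall (a : R) k m, T (beta ((a : R^c) *: k) m - beta k (a *: m))) ->
  forall k m, tpure k m = 0 -> T (beta k m).
Proof.
move=> T0 TB TDl TDr Tbal k m /tensor_class_eq0.
pose phi (u : {freeg (K * M)}) : V :=
  fglift (fun km => beta km.1 km.2 : zmodule V) u.
have phiB u v : phi (u - v) = phi u - phi v.
  exact: (@lift_is_additive _ _ (zmodule V)).
have phi1 k' m' : phi << (k', m') >> = beta k' m'.
  by rewrite /phi liftU scale1r.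
rewrite -phi1; elim=> {k m} [|u v _ Tu _ Tv|k1 k2 m|k m1 m2|a k m].
- by have := phiB 0 0; rewrite !subrr => ->.
- by rewrite phiB; apply: TB.
- by rewrite !phiB !phi1.
- by rewrite !phiB !phi1.
- by rewrite !phiB !phi1.
Qed.

Section Relations.
Variables (R : pzRingType) (M : lmodType R).

(** The subgroup rann(s) M of M, where rann(s) is the right annihilator of [s]. *)
Definition rann_sum (s : seq R) : set M :=
  [set m | exists2 t : seq (R * M),
     (forall p, p \in t -> annihilates s (p.1 : R^o)) &
     m = \sum_(p <- t) p.1 *: p.2].

Lemma rann_sum0 s : rann_sum s 0.
Proof. by exists [::]; rewrite ?big_nil. Qed.

Lemma rann_sum1 s (c : R) m : annihilates s (c : R^o) -> rann_sum s (c *: m).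
Proof.
by move=> sc; exists [:: (c, m)] => [p|]; rewrite ?big_seq1 // inE => /eqP ->.
Qed.

Lemma rann_sumB s u v : rann_sum s u -> rann_sum s v -> rann_sum s (u - v).
Proof.
move=> [t tP ->] [t' tP' ->].
exists (t ++ [seq (p.1, - p.2) | p <- t']) => [p|].
  by rewrite mem_cat => /orP[/tP|/mapP[q /tP' h ->]].
rewrite big_cat big_map -sumrN; congr (_ + _).
by apply: eq_bigr => p _; rewrite scalerN.
Qed.

(** With e_i the standard basis, k (x) m is the sum of the e_i a_i (x) m, and
    each a_i moves across the tensor sign to kill m. *)
Lemma tpure_row0 (s : seq R) (m : M) :
  annihilates s m ->
  tpure ((\row_(i < size s) s`_i : 'rV[R]_(size s)) : 'rV[R^c]_(size s)) m = 0.
Proof.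
move=> sm; set k : 'rV[R^c]_ _ := (X in tpure X _).
have tpure0 (k' : 'rV[R^c]_(size s)) : tpure k' (0 : M) = 0.
  by apply: (@addrI _ (tpure k' 0)); rewrite -tpureDr !addr0.
have tpure0l : tpure (0 : 'rV[R^c]_(size s)) m = 0.
  by apply: (@addrI _ (tpure 0 m)); rewrite -tpureDl !addr0.
rewrite (row_sum_delta k).
have tpure_sum (I : finType) (f : I -> 'rV[R^c]_(size s)) :
    tpure (\sum_i f i) m = \sum_i tpure (f i) m.
  by apply: (big_morph (fun k => tpure k m)) => [? ?|]; rewrite ?tpureDl.
rewrite tpure_sum big1 // => i _.
by rewrite (tpure_bal (k 0 i : R)) !mxE sm ?tpure0 ?mem_nth.
Qed.

(** The map k c (x) m |-> c m is well defined from k R (x) M to M / rann(s) M,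
    where k is the row of the entries of [s]; it sends k (x) m, which is 0 by
    flatness, to the class of m. *)
Lemma mn_flat1_relation (s : seq R) (m : M) :
  mn_flat (size s) 1 M -> annihilates s m -> rann_sum s m.
Proof.
move=> flatM sm.
pose k : 'rV[R^c]_(size s) := \row_(i < size s) (s`_i : R^c).
pose g := (fun=> k) : 'I_1 -> 'rV[R^c]_(size s).
have gk : k \in submod_gen_pred g.
  by apply/asboolP; exists (fun=> 1); rewrite big_ord1 scale1r.
pose kK : submod_gen g := SubmodGen gk.
have kK0 : tpure kK m = 0.
  by apply: (flatM g); rewrite tensor_map_pure raddf0; apply: tpure_row0.
have kill (c : R) : (c : R^c) *: k = 0 -> annihilates s (c : R^o).
  move=> ck0 a /(nthP 0)[i si <-].
  by move/rowP/(_ (Ordinal si)): ck0; rewrite !mxE.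
have /choice[coef coefP] (x : submod_gen g) :
    exists c : R, val x = (c : R^c) *: k.
  by have /asboolP[c ->] := valP x; exists (c 0); rewrite big_ord1.
(* As k c determines c up to the right annihilator of s, coef is R-linear modulo it,
   so (x, v) |-> coef x *: v is biadditive and balanced modulo rann(s) M. *)
have coef_comb (x : submod_gen g) (c : R) :
    val x = (c : R^c) *: k -> annihilates s (coef x - c : R^o).
  by move=> xc; apply: kill; rewrite scalerBl -coefP xc subrr.
have coef_m : rann_sum s (coef kK *: m).
  apply: (tpure0_balanced_map (beta := fun x m => coef x *: m) _ _ _ _ _ kK0).
  - exact: rann_sum0.
  - exact: rann_sumB.
  - move=> x y v; rewrite -!scalerBl -addrA -opprD; apply: rann_sum1.
    by apply: coef_comb; rewrite scalerDl -!coefP.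
  - by move=> x u v; rewrite scalerDr addrAC addrK subrr; apply: rann_sum0.
  - move=> a x v; rewrite scalerA -scalerBl; apply: rann_sum1.
    apply: coef_comb; rewrite -[RHS]/((a : R^c) * (coef x : R^c) *: k).
    by rewrite -scalerA -coefP.
have sc1 : annihilates s (coef kK - 1 : R^o).
  by apply: coef_comb; rewrite scale1r.
have := rann_sumB coef_m (rann_sum1 m sc1).
by rewrite scalerBl scale1r opprB addrC subrK.
Qed.

End Relations.

(** * Factoring through a finite free module *)

Section Factorization.
Variables (R : pzRingType) (q : nat).

Let dsum_ord_finsupp (u : 'I_q -> R) : u \in @finsupp_pred R 'I_q R^o.
Proof. by apply/asboolP; apply: (sub_finite_set (@subsetT _ _)). Qed.

Lemma cyclic_to_free (C : lmodType R) (x : C) (b : 'I_q -> R) :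
  (forall y : C, exists a : R, y = a *: x) ->
  (forall a, a *: x = 0 -> forall j, a * b j = 0) ->
  exists g : {linear C -> dsum 'I_q R^o}, forall j, val (g x) j = b j.
Proof.
move=> /choice[coef coefP] xb.
have coefE y a j : y = a *: x -> coef y * b j = a * b j.
  move=> ya; apply/eqP; rewrite -subr_eq0 -mulrBl; apply/eqP/xb.
  by rewrite scalerBl -coefP ya subrr.
pose g y : dsum 'I_q R^o := DSum (dsum_ord_finsupp (fun j => coef y * b j)).
have g_lin : linear g.
  move=> a y z; apply/val_inj/funext => j /=.
  change (coef (a *: y + z) * b j = a * (coef y * b j) + coef z * b j).
  rewrite (coefE _ (a * coef y + coef z)) ?mulrDl ?mulrA //.
  by rewrite scalerDl -scalerA -!coefP.
pose gm := GRing.isLinear.Build _ _ _ _ g g_lin.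
pose gL : {linear C -> dsum 'I_q R^o} := HB.pack g gm.
exists gL => j.
by change (coef x * b j = b j); rewrite (coefE _ 1) ?mul1r ?scale1r.
Qed.

Lemma free_to_module (M : lmodType R) (m : 'I_q -> M) :
  exists h : {linear dsum 'I_q R^o -> M},
    forall u, h u = \sum_j (val u j : R) *: m j.
Proof.
pose h (u : dsum 'I_q R^o) : M := \sum_j (val u j : R) *: m j.
have h_lin : linear h.
  move=> a u v; rewrite /h scaler_sumr -big_split; apply: eq_bigr => j _ /=.
  by rewrite scalerA -scalerDl.
pose hm := GRing.isLinear.Build _ _ _ _ h h_lin.
pose hL : {linear dsum 'I_q R^o -> M} := HB.pack h hm.
by exists hL.
Qed.

End Factorization.

Theorem proposition3p1 (R : pzRingType) (hR : @sigma_semi_compact R R^o)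
  (M : lmodType R) (hM : aleph0_1_flat M) : singly_projective M.
Proof.
move=> C f [x x_gen].
have [s sx s_ann] :=
  sigma_semi_compact_finite_annihilator [set a : R | a *: x = 0] hR.
(* The leading 0 keeps the list nonempty: flatness is about R^p with p > 0. *)
have [t t_ann fx] : rann_sum (0 :: s) (f x).
  apply: mn_flat1_relation; first exact: hM.
  move=> a; rewrite inE => /predU1P[->|/sx ax]; first by rewrite scale0r.
  by rewrite -linearZ ax linear0.
pose p (j : 'I_(size t)) := tnth (in_tuple t) j.
have [a ax j|g gx] := @cyclic_to_free _ _ _ _ (fun j => (p j).1) x_gen _.
  apply: (s_ann _ _ a ax) => c sc; apply: (t_ann _ (mem_tnth _ (in_tuple t))).
  by rewrite inE sc orbT.
have [h hE] := free_to_module (fun j => (p j).2).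
exists (dsum 'I_(size t) R^o), g, h; split.
  by exists 'I_(size t), idfun; exists idfun.
move=> y; have [a ->] := x_gen y; rewrite /= !linearZ fx hE big_tnth.
by congr (_ *: _); apply: eq_bigr => j _; rewrite gx.
Qed.
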